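(* Fix $\delta>-1$ and $n\ge 1$. (a) Let $\boldsymbol{\mathcal D}^A(n)=(D^A_1(n),\dots,D^A_n(n))$ be the degree sequence of $G(n)$ in Model A, and let $$\widetilde{\boldsymbol{\mathcal D}}^A(n):=\bigl(BI_1(T^A_n),\,BI_2(T^A_n-T^A_2),\,\dots,\,BI_{n-1}(T^A_n-T^A_{n-1}),\,BI_n(0)\bigr).$$ Then $\boldsymbol{\mathcal D}^A(n)$ and $\widetilde{\boldsymbol{\mathcal D}}^A(n)$ have the same distribution on $\mathbb R^n$. (b) Let $\boldsymbol{\mathcal D}^B(n)=(D^B_1(n),\dots,D^B_n(n))$ be the degree sequence of $G(n)$ in Model B, and let $$\widetilde{\boldsymbol{\mathcal D}}^B(n):=\bigl(BI_1(T^B_n),\,BI_2(T^B_n),\,BI_3(T^B_n-T^B_2),\,\dots,\,BI_{n}(T^B_n-T^B_{n-1})\bigr),$$ i.e. the $i$-th coordinate is $BI_i(T^B_n-T^B_{i-1})$. Then $\boldsymbol{\mathcal D}^B(n)$ and $\widetilde{\boldsymbol{\mathcal D}}^B(n)$ have the same distribution on $\mathbb R^n$.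
   Context: Let $\delta>-1$. Degrees: a self loop contributes 2 to the degree of its node. Model A: $G(1)$ consists of a single node $v_1$ with a self loop (so $v_1$ has degree 2). For $n\ge1$, given $G(n)$ (nodes $v_1,\dots,v_n$, $n$ edges), $G(n+1)$ is obtained by adding a new node $v_{n+1}$ and one edge joining $v_{n+1}$ to an existing node $v_i$, $1\le i\le n$, chosen with probability $\frac{D_i(n)+\delta}{(2+\delta)n}$, where $D_i(n)$ is the degree of $v_i$ in $G(n)$. Model B: $G(1)$ is as in Model A. For $n\ge1$, given $G(n)$, $G(n+1)$ is obtained either by adding a new node $v_{n+1}$ and an edge joining it to $v_i$, with probability $\frac{D_i(n)+\delta}{(2+\delta)n+1+\delta}$ for each $1\le i\le n$, or by adding a new node $v_{n+1}$ with a self loop, with probability $\frac{1+\delta}{(2+\delta)n+1+\delta}$. B.I. processes: let $\{BI_i(t):t\ge0\}_{i\ge1}$ be independent continuous-time Markov pure-jump processes on the integers with transition rate $q_{j,j+1}=j+\delta$ (only upward jumps by 1), with $BI_1(0)=2$ and $BI_i(0)=1$ for $i\ge2$. Let $\tau^{(i)}_k$ be the $k$-th jump time of $BI_i$ ($\tau^{(i)}_0=0$). Branching times for Model A: $T^A_1=0$ and for $n\ge1$, $T^A_{n+1}:=\min\{T^A_i+\tau^{(i)}_k: k\ge1,\ 1\le i\le n,\ T^A_i+\tau^{(i)}_k>T^A_n\}$ (the $i$-th process is run as $BI_i(t-T^A_i)$, $t\ge T^A_i$; in particular $T^A_2=\tau^{(1)}_1$). Branching times for Model B: $T^B_0=T^B_1=0$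 and for $n\ge1$, $T^B_{n+1}:=\min\{T^B_{i-1}+\tau^{(i)}_k: k\ge1,\ 1\le i\le n+1,\ T^B_{i-1}+\tau^{(i)}_k>T^B_n\}$ (the $i$-th process is run as $BI_i(t-T^B_{i-1})$, $t\ge T^B_{i-1}$). *)

(* Defs.v *)
From HB Require Import structures.
From mathcomp Require Import all_boot all_order all_algebra.
From mathcomp Require Import all_classical all_reals all_analysis.
Set Implicit Arguments. Unset Strict Implicit. Unset Printing Implicit Defensive.
Import Order.TTheory GRing.Theory Num.Theory.
Local Open Scope classical_set_scope.
Local Open Scope ring_scope.

(* Random graphs, represented by edge lists over nodes 1..n.           *)
(* An edge is an (unordered) pair (a,b); (a,a) is a self loop.         *)

(* degree of node v: a self loop (v,v) contributes 2 *)
Definition degree (G : seq (nat * nat)) (v : nat) : nat :=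
  \sum_(e <- G) ((e.1 == v) + (e.2 == v))%N.

Definition degseq (n : nat) (G : seq (nat * nat)) : seq nat :=
  [seq degree G i | i <- iota 1 n].

(* The law of G(n) as a finite list of (graph, probability) pairs. *)
Section Laws.
Variable R : realType.
Variable delta : R.

Definition stepA (n : nat) (gp : seq (nat * nat) * R) : seq (seq (nat * nat) * R) :=
  [seq (rcons gp.1 (n.+1, i),
        gp.2 * (((degree gp.1 i)%:R + delta) / ((2 + delta) * n%:R)))
  | i <- iota 1 n].

Fixpoint lawA (n : nat) : seq (seq (nat * nat) * R) :=
  match n with
  | 0 => [::]
  | n'.+1 => if n' == 0%N then [:: ([:: (1, 1)], 1)]
             else flatten [seq stepA n' gp | gp <- lawA n']
  end.

Definition stepB (n : nat) (gp : seq (nat * nat) * R) : seq (seq (nat * nat) * R) :=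
  (rcons gp.1 (n.+1, n.+1),
     gp.2 * ((1 + delta) / ((2 + delta) * n%:R + 1 + delta))) ::
  [seq (rcons gp.1 (n.+1, i),
        gp.2 * (((degree gp.1 i)%:R + delta) / ((2 + delta) * n%:R + 1 + delta)))
  | i <- iota 1 n].

Fixpoint lawB (n : nat) : seq (seq (nat * nat) * R) :=
  match n with
  | 0 => [::]
  | n'.+1 => if n' == 0%N then [:: ([:: (1, 1)], 1)]
             else flatten [seq stepB n' gp | gp <- lawB n']
  end.

Definition degpmfA (n : nat) (ds : seq nat) : R :=
  \sum_(gp <- lawA n | degseq n gp.1 == ds) gp.2.
Definition degpmfB (n : nat) (ds : seq nat) : R :=
  \sum_(gp <- lawB n | degseq n gp.1 == ds) gp.2.
End Laws.

(* B.I. processes, built from their holding times.                     *)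
(* H i k = holding time of BI_i before its k-th jump (i, k >= 1).      *)

Definition BIinit (i : nat) : nat := if i == 1%N then 2 else 1.

Section BI.
Context {R : realType} {d : measure_display} {T : measurableType d}.

Definition mutually_independent (P : probability T R) (I : eqType)
    (J : I -> Prop) (X : I -> T -> R) : Prop :=
  forall (s : seq I) (B : I -> set R),
    uniq s -> (forall i, i \in s -> J i) -> (forall i, measurable (B i)) ->
    P (\bigcap_(i in [set j | j \in s]) (X i @^-1` B i)) =
    (\prod_(i <- s) P (X i @^-1` B i))%E.

Definition exponential_law (P : probability T R) (lam : R) (X : T -> R) : Prop :=
  measurable_fun setT X /\
  forall x : R, P [set w | X w <= x] =
                (if x < 0 then 0 else 1 - expR (- lam * x))%:E.

(* The holding times of the independent B.I. processes {BI_i}_{i>=1}: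
   in state j the process jumps to j+1 at rate j+delta, so the k-th
   holding time of BI_i (which starts in BIinit i) has rate
   BIinit i + k - 1 + delta; all holding times are independent. *)
Definition BI_holding_times (P : probability T R) (delta : R)
    (H : nat -> nat -> T -> R) : Prop :=
  (forall i k, (1 <= i)%N -> (1 <= k)%N ->
     exponential_law P ((BIinit i + k - 1)%:R + delta) (H i k)) /\
  mutually_independent P (fun ik : nat * nat => (1 <= ik.1)%N /\ (1 <= ik.2)%N)
    (fun ik => H ik.1 ik.2).

Variable H : nat -> nat -> T -> R.

Definition tau (i k : nat) (w : T) : R := \sum_(1 <= j < k.+1) H i j w.

(* the event BI_i(t) = v : the process has made exactly v - BIinit i
   jumps by time t, i.e. tau_m <= t < tau_{m+1} with m = v - BIinit i *)
Definition BI_is (i : nat) (t : R) (v : nat) (w : T) : Prop :=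
  (BIinit i <= v)%N /\
  tau i (v - BIinit i) w <= t < tau i (v - BIinit i).+1 w.

(* Branching times for Model A: TAf n w j = T^A_j for 1 <= j <= n *)
Fixpoint TAf (n : nat) (w : T) : nat -> R :=
  match n with
  | 0 => fun _ => 0
  | n'.+1 =>
      let f := TAf n' w in
      if n' == 0%N then fun _ => 0 else
      fun j => if (j <= n')%N then f j else
        inf [set x | exists i k, (1 <= i <= n')%N /\ (1 <= k)%N /\
                     x = f i + tau i k w /\ f n' < x]
  end.
Definition TA (n : nat) (w : T) : R := TAf n w n.

(* Branching times for Model B: TBf n w j = T^B_j for 0 <= j <= n *)
Fixpoint TBf (n : nat) (w : T) : nat -> R :=
  match n with
  | 0 => fun _ => 0
  | n'.+1 =>
      let f := TBf n' w in
      if n' == 0%N then fun _ => 0 else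
      fun j => if (j <= n')%N then f j else
        inf [set x | exists i k, (1 <= i <= n'.+1)%N /\ (1 <= k)%N /\
                     x = f i.-1 + tau i k w /\ f n' < x]
  end.
Definition TB (n : nat) (w : T) : R := TBf n w n.

Definition tildeDA_is (n : nat) (ds : seq nat) : set T :=
  [set w | forall i, (1 <= i <= n)%N ->
     BI_is i (TA n w - TA i w) (nth 0%N ds i.-1) w].

Definition tildeDB_is (n : nat) (ds : seq nat) : set T :=
  [set w | forall i, (1 <= i <= n)%N ->
     BI_is i (TB n w - TB i.-1 w) (nth 0%N ds i.-1) w].
End BI.

(* Main.v *)
(* Watch the processes only at the branching times. Given which process made
   each of the first jumps, the clocks still running are independent exponential
   variables whose rates are the current degrees plus delta, and they are
   independent of the clocks not yet started: when clock i wins a race, the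
   overshoots Y_c - Y_i of the others are again exponential with unchanged rates
   and independent of the winner (lack of memory), the winner being i with
   probability lam_i / sum lam, which is the preferential attachment probability.
   So every history of jumps has the probability of the graph that it encodes,
   and these probabilities add up to 1.

   The race is evaluated without densities: cut the time of the winner into
   cells of width h, compare with two geometric series, and let h tend to 0. *)

Require Import Defs.
From HB Require Import structures.
From mathcomp Require Import all_boot all_order all_algebra.
From mathcomp Require Import all_classical all_reals all_analysis.
From mathcomp Require Import measurable_realfun.
From mathcomp Require Import lra ring zify.
Set Implicit Arguments. Unset Strict Implicit. Unset Printing Implicit Defensive.
Import Order.TTheory GRing.Theory Num.Theory.
Local Open Scope classical_set_scope.
Local Open Scope ring_scope.

(** * Races of exponential clocks *)

(** To first order in h, [1 - expR (- a * h)] is [a * h], so in the limit the two bounds say that x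
    (lam + L) = M lam. The limit is taken by hand, with an explicit h for each error e. *)
Lemma rate_squeeze (R : realType) (x M lam L : R) :
  0 < lam -> 0 <= L -> 0 <= x -> 0 <= M ->
  (forall h, 0 < h ->
     x * (1 - expR (- (lam + L) * h)) <= M * (1 - expR (- lam * h))) ->
  (forall h, 0 < h -> M * (1 - expR (- lam * h)) * expR (- L * h) <=
     x * (1 - expR (- (lam + L) * h))) ->
  x = M * (lam / (lam + L)).
Proof.
move=> lam0 L0 x0 M0 ub lb.
have lL : 0 < lam + L by lra.
have expB (a h : R) : 0 < a -> 0 < h -> a * h <= (1 - expR (- a * h)) * (1 + a * h).
  move=> a0 h0; have ah : 0 < a * h by rewrite mulr_gt0.
  have := expR_ge1Dx (a * h); rewrite mulNr expRN => le1.
  have e0 := expR_gt0 (a * h).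
  suff: (expR (a * h))^-1 * (1 + a * h) <= 1 by lra.
  by rewrite mulrC ler_pdivrMr// mul1r.
have expU (a h : R) : 1 - expR (- a * h) <= a * h.
  by have := expR_ge1Dx (- a * h); lra.
suff e : M * lam = x * (lam + L) by rewrite mulrA e mulfK ?gt_eqF.
apply/le_anti/andP; split; apply/ler_addgt0Pr => e e0.
(* After division by h the lower bound will read M lam (1 - L h) <= x (lam + L) (1 + lam h); [K]
   collects the coefficients of h, and the 1 keeps it positive. *)
- pose K := M * lam * L + x * (lam + L) * lam + 1.
  have K0 : 0 < K by rewrite /K ltr_pwDr// addr_ge0// !mulr_ge0// ltW.
  pose h := e / K; have h0 : 0 < h by rewrite divr_gt0.
  have hK : h * K = e by rewrite /h divfK ?gt_eqF.
  have := lb h h0; have b1 := expB _ _ lam0 h0; have b2 := expU (lam + L) h.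
  have b3 := expR_ge1Dx (- L * h).
  set u := 1 - expR (- lam * h) in b1 *; set v := expR (- L * h) in b3 *.
  set z := 1 - _ in b2 * => le1.
  have u0 : 0 <= u by rewrite /u subr_ge0 -expR0 ler_expR mulNr oppr_le0 mulr_ge0// ltW.
  have le2 : M * u * (1 - L * h) <= x * ((lam + L) * h).
    apply: (le_trans _ (le_trans le1 _)); last by rewrite ler_wpM2l.
    by rewrite ler_wpM2l ?mulr_ge0//; lra.
  have le3 : M * u * (1 + lam * h) * (1 - L * h) <= x * ((lam + L) * h) * (1 + lam * h).
    by rewrite [leLHS]mulrAC ler_wpM2r// addr_ge0// mulr_ge0// ltW.
  (* If this factor is not positive, it cannot multiply the bound on u, but then M lam <= M lam L h
     <= h K = e at once. *)
  have [hL|hL] := leP (1 - L * h) 0.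
    have : M * lam <= M * lam * (L * h) by rewrite ler_peMr// ?mulr_ge0 ?(ltW lam0)//; lra.
    have xl : 0 <= x * (lam + L) by rewrite mulr_ge0// ltW.
    have := mulr_ge0 (mulr_ge0 xl (ltW lam0)) (ltW h0).
    by rewrite -hK /K; lra.
  have le4 : M * (lam * h) * (1 - L * h) <= M * u * (1 + lam * h) * (1 - L * h).
    by rewrite ler_wpM2r ?(ltW hL)// -mulrA ler_wpM2l.
  have : h * (M * lam * (1 - L * h)) <= h * (x * (lam + L) * (1 + lam * h)) by lra.
  by rewrite ler_pM2l// -hK /K; lra.
- pose K := M * lam * (lam + L) + 1.
  have K0 : 0 < K by rewrite /K ltr_pwDr// !mulr_ge0// ltW.
  pose h := e / K; have h0 : 0 < h by rewrite divr_gt0.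
  have hK : h * K = e by rewrite /h divfK ?gt_eqF.
  have := ub h h0; have b1 := expB _ _ lL h0; have b2 := expU lam h.
  set z := 1 - expR (- (lam + L) * h) in b1 *; set u := 1 - _ in b2 * => le1.
  have hp : 0 <= 1 + (lam + L) * h by rewrite addr_ge0// mulr_ge0// ltW.
  have le2 : x * ((lam + L) * h) <= M * u * (1 + (lam + L) * h).
    by apply: le_trans (ler_wpM2r hp le1); rewrite -mulrA ler_wpM2l.
  have le3 : M * u * (1 + (lam + L) * h) <= M * (lam * h) * (1 + (lam + L) * h).
    by rewrite ler_wpM2r// ler_wpM2l.
  have : h * (x * (lam + L)) <= h * (M * lam * (1 + (lam + L) * h)) by lra.
  by rewrite ler_pM2l// -hK /K; lra.
Qed.

Lemma nneseries_geometric (R : realType) (a q : R) : 0 <= q < 1 ->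
  (\sum_(0 <= k <oo) (a * q ^+ k)%:E)%E = (a / (1 - q))%:E.
Proof.
move=> /andP[q0 q1]; apply/cvg_lim => //.
rewrite (_ : (fun n => _) = EFin \o series (geometric a q)); last first.
  by apply/funext => n /=; rewrite sumEFin.
by apply: cvg_EFin; [exact: nearW|apply: cvg_geometric_series; rewrite ger0_norm].
Qed.

(** * Independent exponential clocks and the winner of a race *)

Section ExponentialClocks.
Context {R : realType} {d : measure_display} {T : measurableType d}.
Variable P : probability T R.

Lemma measurable_set_oc (Z : T -> R) (x y : R) :
  measurable_fun setT Z -> measurable [set w | x < Z w <= y].
Proof.
move=> mZ; rewrite (_ : [set _ | _] = Z @^-1` `]x, y]%classic).
  by rewrite -[_ @^-1` _]setTI; exact: mZ.
by apply/seteqP; split => w /=; rewrite in_itv.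
Qed.

(** The cells ]k h, (k+1) h] are disjoint and cover the positive reals: the right end of the cell of
    Z is given by the least k with Z <= k h, which is not 0 because Z > 0. *)
Lemma probability_grid (E : set T) (Z : T -> R) (h : R) :
  measurable E -> measurable_fun setT Z -> (forall w, E w -> 0 < Z w) -> 0 < h ->
  P E = (\sum_(0 <= k <oo)
           P (E `&` [set w | (k%:R * h < Z w <= k.+1%:R * h)%R]))%E.
Proof.
move=> mE mZ Z0 h0.
pose F (k : nat) := E `&` [set w | k%:R * h < Z w <= k.+1%:R * h].
have mF k : measurable (F k) by apply: measurableI => //; exact: measurable_set_oc.
have tF : trivIset setT F.
  apply/trivIsetP => i j _ _ ij; apply/seteqP; split => // w [[Ew /=]].
  move=> /andP[i1 i2] [_ /= /andP[j1 j2]].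
  have : i%:R * h < j.+1%:R * h by exact: lt_le_trans i1 j2.
  have : j%:R * h < i.+1%:R * h by exact: lt_le_trans j1 i2.
  by rewrite !ltr_pM2r// !ltr_nat; move: ij => /eqP; lia.
rewrite -measure_semi_bigcup//; last exact: bigcupT_measurable.
congr (P _); apply/seteqP; split => w; last by case=> k _ [].
move=> Ew; have Zw := Z0 _ Ew.
have ex : exists k, Z w <= k%:R * h.
  exists (Num.truncn (Z w / h)).+1; rewrite -ler_pdivrMr// ltW//.
  by apply: truncnS_gt.
case: (ex_minnP ex) => -[|k]; first by rewrite mul0r leNgt Zw.
move=> kle kmin; exists k => //; split => //=; rewrite kle andbT ltNge.
by apply/negP => /kmin; rewrite ltnn.
Qed.

Lemma measurable_set_ltr (f g : T -> R) :
  measurable_fun setT f -> measurable_fun setT g -> measurable [set w | f w < g w].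
Proof.
move=> mf mg; rewrite (_ : [set _ | _] = setT `&` (fun w => f w < g w) @^-1` [set true]).
  exact: measurable_fun_ltr.
by rewrite setTI; apply/seteqP; split.
Qed.

(** A conditional law given [E], stated without division: empty [s] gives P E = p, and in general
    the clocks in [L] have the joint tail of independent exponential variables. *)
Definition exp_clocks (I : eqType) (E : set T) (p : R) (L : I -> Prop)
    (lam : I -> R) (Y : I -> T -> R) : Prop :=
  forall (s : seq I) (y : I -> R),
    uniq s -> (forall c, c \in s -> L c) -> (forall c, c \in s -> 0 <= y c) ->
    P (E `&` [set w | forall c, c \in s -> y c < Y c w]) =
      (p * \prod_(c <- s) expR (- lam c * y c))%:E.

Lemma measurable_forall_seq (I : choiceType) (s : seq I) (B : I -> set T) :
  (forall c, c \in s -> measurable (B c)) ->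
  measurable [set w | forall c, c \in s -> B c w].
Proof.
move=> mB; rewrite (_ : [set _ | _] = \bigcap_(c in [set` s]) B c).
  by apply: fin_bigcap_measurable => //; exact: finite_seq.
by apply/seteqP; split => w /= H c; exact: H.
Qed.

Section Race.
Variables (I : choiceType) (E : set T) (p : R) (L : I -> Prop).
Variables (lam : I -> R) (Y : I -> T -> R) (a : seq I) (i : I).
Hypothesis mE : measurable E.
Hypothesis mY : forall c, L c -> measurable_fun setT (Y c).
Hypothesis lam0 : forall c, L c -> 0 < lam c.
Hypothesis clocks : exp_clocks E p L lam Y.
Hypothesis ua : uniq a.
Hypothesis aL : forall c, c \in a -> L c.
Hypothesis ia : i \in a.
Hypothesis Yi0 : forall w, E w -> 0 < Y i w.

Let Lr := \sum_(c <- rem i a) lam c.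

(* The event that clock [i] rings after [r] and every clock of [t] exceeds its
   threshold, the clocks in the race being moved forward by [u]. *)
Let B (t : seq I) (y : I -> R) (r u : R) : set T := E `&`
  [set w | r < Y i w /\ forall c, c \in t -> y c + (c \in a)%:R * u < Y c w].

(** For a fixed shift u the thresholds are constants, so [clocks] applies; the shift costs a factor
    [expR (- lam c * u)] for each contestant c other than i, in total [expR (- Lr * u)]. *)
Lemma probability_race_thresholds t y r u :
  uniq t -> (forall c, c \in t -> L c) -> (forall c, c \in t -> 0 <= y c) ->
  i \notin t -> {subset rem i a <= t} -> 0 <= r -> 0 <= u ->
  P (B t y r u) = (p * \prod_(c <- t) expR (- lam c * y c)
                   * expR (- lam i * r) * expR (- Lr * u))%:E.
Proof.
move=> ut tL y0 it sat r0 u0.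
pose z c := if c == i then r else y c + (c \in a)%:R * u.
have zE c : c \in t -> z c = y c + (c \in a)%:R * u.
  by move=> ct; rewrite /z; case: eqP => // ci; rewrite -ci ct in it.
rewrite (_ : B t y r u = E `&` [set w | forall c, c \in i :: t -> z c < Y c w]).
  rewrite clocks/= ?it//; last 2 first.
  - by move=> c; rewrite inE => /orP[/eqP->|/tL//]; exact: aL.
  - move=> c; rewrite inE => /orP[/eqP->|ct]; first by rewrite /z eqxx.
    by rewrite zE// addr_ge0 ?y0// mulr_ge0.
  congr EFin; rewrite big_cons {1}/z eqxx.
  under eq_big_seq => c ct.
    rewrite zE// mulrDr expRD mulrA; over.
  rewrite big_split/=.
  suff -> : \prod_(c <- t) expR (- lam c * (c \in a)%:R * u) = expR (- Lr * u).
    by ring.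
  suff sE : \sum_(c <- t) - lam c * (c \in a)%:R = - Lr.
    by rewrite -expR_sum -mulr_suml sE.
  under eq_bigr do rewrite mulNr.
  rewrite sumrN; congr (- _).
  under eq_bigr do rewrite mulr_natr mulrb.
  rewrite -big_mkcond -big_filter; apply: perm_big; apply: uniq_perm.
  - exact: filter_uniq.
  - exact: rem_uniq.
  - move=> c; rewrite mem_filter mem_rem_uniq// inE/=; case: eqP => [->|ci]/=.
      by rewrite (negbTE it) andbF.
    apply/andP/idP => [[]//|ca]; split => //; apply: sat.
    by rewrite mem_rem_uniq// inE ca; apply/andP; split => //; apply/eqP.
apply/seteqP; split => w [Ew /=].
  move=> [rY tY]; split => // c; rewrite inE => /orP[/eqP->|ct].
    by rewrite /z eqxx.
  by rewrite zE//; exact: tY.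
move=> iY; split => //; split; first by have := iY i; rewrite /z eqxx; apply; rewrite mem_head.
by move=> c ct; rewrite -zE//; apply: iY; rewrite inE ct orbT.
Qed.

Let mB t y r u : (forall c, c \in t -> L c) -> measurable (B t y r u).
Proof.
move=> tL; apply: measurableI => //; apply: measurableI.
  by apply: measurable_set_ltr => //; exact: mY (aL ia).
apply: measurable_forall_seq => c ct; apply: measurable_set_ltr => //.
exact: mY (tL _ ct).
Qed.

(** With equal shifts, the difference of the two tail events confines clock i to ]r, r']. *)
Lemma probability_race_grid t y r r' u :
  uniq t -> (forall c, c \in t -> L c) -> (forall c, c \in t -> 0 <= y c) ->
  i \notin t -> {subset rem i a <= t} -> 0 <= r -> r <= r' -> 0 <= u ->
  P (B t y r u `\` B t y r' u) = (p * \prod_(c <- t) expR (- lam c * y c)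
       * (expR (- lam i * r) - expR (- lam i * r')) * expR (- Lr * u))%:E.
Proof.
move=> ut tL y0 it sat r0 rr u0.
transitivity (P (B t y r u) - P (B t y r' u))%E.
  rewrite measureD; [|exact: mB|exact: mB|]; last first.
    by apply: (le_lt_trans (probability_le1 _ _)); [exact: mB|exact: ltry].
  rewrite setIidr//.
  by move=> w [Ew [rY tY]]; split => //; split => //; exact: le_lt_trans rY.
rewrite !probability_race_thresholds//; last exact: le_trans rr.
by rewrite -EFinB; congr EFin; ring.
Qed.

(** Lack of memory and the law of the winner in one. When clock i rings in ]k h, (k+1) h], the
    random thresholds y + Y_i lie between y + k h and y + (k+1) h; summed over k, both bounds are
    geometric series of ratio [expR (- (lam i + Lr) * h)], and [rate_squeeze] takes the limit. *)
Lemma exp_clocks_race :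
  exp_clocks (E `&` [set w | forall c, c \in a -> c != i -> Y i w < Y c w])
    (p * (lam i / \sum_(c <- a) lam c)) (fun c => L c /\ c != i) lam
    (fun c w => if c \in a then Y c w - Y i w else Y c w).
Proof.
move=> s y us sL ys.
(* Contestants outside [s] join with threshold 0: they only have to ring after i, and a zero
   threshold contributes the factor 1. *)
pose t := undup (s ++ rem i a).
pose y' c := if c \in s then y c else 0.
have memt c : c \in t = (c \in s) || ((c != i) && (c \in a)).
  by rewrite mem_undup mem_cat mem_rem_uniq.
have is_ : i \notin s by apply/negP => /sL[_]; rewrite eqxx.
have it : i \notin t by rewrite memt eqxx orbF.
have ut : uniq t by exact: undup_uniq.
have tL c : c \in t -> L c.
  by rewrite memt => /orP[/sL[]//|/andP[_ /aL]].
have y'0 c : c \in t -> 0 <= y' c by move=> _; rewrite /y'; case: ifP => // /ys.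
have sat : {subset rem i a <= t}.
  by move=> c; rewrite mem_rem_uniq// inE memt => ->; rewrite orbT.
pose M := p * \prod_(c <- s) expR (- lam c * y c).
have ME : p * \prod_(c <- t) expR (- lam c * y' c) = M.
  congr (_ * _).
  rewrite [LHS](_ : _ = \prod_(c <- t | c \in s) expR (- lam c * y c)).
    rewrite -big_filter; apply: perm_big; apply: uniq_perm => //.
      exact: filter_uniq.
    by move=> c; rewrite mem_filter memt; case: (c \in s).
  rewrite [RHS]big_mkcond; apply: eq_bigr => c _; rewrite /y'.
  by case: ifP => // _; rewrite mulr0 expR0.
(* As [y'] is nonnegative, winning the race and passing the thresholds merge into a single family of
   random thresholds. *)
pose F := E `&` [set w | forall c, c \in t -> y' c + (c \in a)%:R * Y i w < Y c w].
have mF : measurable F.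
  apply: measurableI => //; apply: measurable_forall_seq => c ct.
  apply: measurable_set_ltr; last exact: mY (tL _ ct).
  by apply: measurable_funD => //; apply: measurable_funM => //; exact: mY (aL ia).
rewrite [X in P X](_ : _ = F); last first.
  apply/seteqP; split => w.
    move=> [[Ew race] sY]; split => //= c; rewrite memt /y'.
    case: (boolP (c \in s)) => [/sY /=|_ /= /andP[ci ca]].
      by case: (c \in a) => /=; lra.
    by rewrite ca /=; have := race _ ca ci; lra.
  move=> [Ew tY]; split; last first.
    move=> c cs; have := tY c; rewrite memt cs => /(_ isT); rewrite /y' cs.
    by case: (c \in a) => /=; lra.
  split => // c ca ci; have ct : c \in t by rewrite memt ca ci orbT.
  by have := tY c ct; have := y'0 c ct; rewrite ca /=; lra.
have lami : 0 < lam i by exact: lam0 (aL ia).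
have Lr0 : 0 <= Lr.
  rewrite /Lr big_seq; apply: sumr_ge0 => c; rewrite mem_rem_uniq// inE.
  by move=> /andP[_ /aL/lam0/ltW].
have sumE : \sum_(c <- a) lam c = lam i + Lr by rewrite (big_rem _ ia).
have M0 : 0 <= M.
  rewrite -lee_fin -(clocks us) => [|c /sL[]//|//].
  exact: measure_ge0.
have fF : P F \is a fin_num by exact: fin_num_measure.
rewrite -(fineK fF); congr EFin; rewrite mulrAC -/M sumE.
have qlt h : 0 < h -> 0 <= expR (- (lam i + Lr) * h) < 1.
  by move=> h0; rewrite expR_ge0 -expR0 ltr_expR mulNr oppr_lt0 mulr_gt0// ltr_pwDl.
have qk h (k : nat) : expR (- lam i * (k%:R * h)) * expR (- Lr * (k%:R * h)) =
    expR (- (lam i + Lr) * h) ^+ k.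
  by rewrite -expRM_natl -expRD; congr expR; ring.
have kS h (k : nat) : expR (- lam i * (k.+1%:R * h)) =
    expR (- lam i * (k%:R * h)) * expR (- lam i * h).
  by rewrite -expRD -natr1; congr expR; ring.
apply: rate_squeeze => //; first exact: fine_ge0.
(* Upper bound: shifting only by the left end of the cell lowers the thresholds and enlarges the
   event. *)
- move=> h h0; have /andP[q0 q1] := qlt h h0.
  rewrite -ler_pdivlMr ?subr_gt0// -lee_fin fineK//.
  rewrite -nneseries_geometric ?q0// (@probability_grid _ (Y i) h)//; last 2 first.
  - exact: mY (aL ia).
  - by move=> w [/Yi0].
  apply: lee_nneseries => [k _ _|k _]; first exact: measure_ge0.
  have kh : 0 <= k%:R * h by rewrite mulr_ge0// ltW.
  have kkh : k%:R * h <= k.+1%:R * h by rewrite ler_pM2r// ler_nat.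
  apply: (@le_trans _ _ (P (B t y' (k%:R * h) (k%:R * h) `\`
                            B t y' (k.+1%:R * h) (k%:R * h)))).
    apply: le_measure; rewrite ?inE.
    + by apply: measurableI => //; exact: measurable_set_oc (mY (aL ia)).
    + by apply: measurableD; exact: mB.
    + move=> w [[Ew tY] /= /andP[kY Yk]]; split.
        split => //; split => // c ct; apply: le_lt_trans (tY c ct).
        by rewrite lerD2l ler_wpM2l// ltW.
      by move=> [_ [+ _]]; rewrite ltNge Yk.
  rewrite probability_race_grid// ME lee_fin -qk kS.
  by rewrite le_eqVlt; apply/orP; left; apply/eqP; ring.
(* Lower bound: shifting by the right end of the cell shrinks the event and costs one more factor
   [expR (- Lr * h)]. *)
- move=> h h0; have /andP[q0 q1] := qlt h h0.
  rewrite -ler_pdivrMr ?subr_gt0// -lee_fin fineK//.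
  rewrite -nneseries_geometric ?q0// (@probability_grid F (Y i) h)//; last 2 first.
  - exact: mY (aL ia).
  - by move=> w [/Yi0].
  have u0 : 0 <= 1 - expR (- lam i * h).
    by rewrite subr_ge0 -expR0 ler_expR mulNr oppr_le0 mulr_ge0// ltW.
  apply: lee_nneseries => [k _ _|k _].
    rewrite lee_fin.
    exact: mulr_ge0 (mulr_ge0 (mulr_ge0 M0 u0) (expR_ge0 _)) (exprn_ge0 _ q0).
  have kh : 0 <= k%:R * h by rewrite mulr_ge0// ltW.
  have kkh : k%:R * h <= k.+1%:R * h by rewrite ler_pM2r// ler_nat.
  have kSh : 0 <= k.+1%:R * h by exact: le_trans kkh.
  apply: (@le_trans _ _ (P (B t y' (k%:R * h) (k.+1%:R * h) `\`
                            B t y' (k.+1%:R * h) (k.+1%:R * h)))).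
    rewrite probability_race_grid// ME lee_fin -qk kS.
    rewrite le_eqVlt; apply/orP; left; apply/eqP.
    have -> : expR (- Lr * (k.+1%:R * h)) = expR (- Lr * (k%:R * h)) * expR (- Lr * h).
      by rewrite -expRD -natr1; congr expR; ring.
    by ring.
  apply: le_measure; rewrite ?inE.
  + by apply: measurableD; exact: mB.
  + by apply: measurableI => //; exact: measurable_set_oc (mY (aL ia)).
  + move=> w [[Ew [kY tY]] nB].
    have Yk : Y i w <= k.+1%:R * h.
      by rewrite leNgt; apply/negP => Yk; apply: nB; split.
    split => /=; last by rewrite kY.
    split => // c ct; apply: le_lt_trans (tY c ct).
    by rewrite lerD2l ler_wpM2l.
Qed.

End Race.
End ExponentialClocks.

(** * Almost surely a race has a winner *)

Section RacePartition.
Context {R : realType} {d : measure_display} {T : measurableType d}.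
Variables (P : probability T R) (I : choiceType) (E : set T) (p : R).
Variables (L : I -> Prop) (lam : I -> R) (Y : I -> T -> R) (a : seq I).
Hypothesis mE : measurable E.
Hypothesis mY : forall c, L c -> measurable_fun setT (Y c).
Hypothesis lam0 : forall c, L c -> 0 < lam c.
Hypothesis clocks : exp_clocks P E p L lam Y.
Hypothesis ua : uniq a.
Hypothesis a0 : a != [::].
Hypothesis aL : forall c, c \in a -> L c.
Hypothesis Y0 : forall c w, c \in a -> E w -> 0 < Y c w.

Let race i := E `&` [set w | forall c, c \in a -> c != i -> Y i w < Y c w].

Lemma measurable_race i : i \in a -> measurable (race i).
Proof.
move=> ia; apply: measurableI => //.
apply: (measurable_forall_seq (B := fun c => [set w | c != i -> Y i w < Y c w])) => c ca.
have [->|ci] := eqVneq c i.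
  by rewrite (_ : [set _ | _] = setT)//; apply/seteqP; split.
rewrite (_ : [set _ | _] = [set w | Y i w < Y c w]); last first.
  by apply/seteqP; split => w /= => [/(_ isT)|].
by apply: measurable_set_ltr; exact: mY (aL _).
Qed.

(** The winning probabilities lam i / sum lam add up to 1, so the disjoint events [race i] together
    have the probability of [E]; ties lie in what they miss, which is therefore null. *)
Lemma race_partition A : measurable A ->
  P (A `&` E) = (\sum_(i <- a) P (A `&` race i))%E.
Proof.
move=> mA; pose U := \bigcup_(i in [set` a]) race i.
have sumP B : measurable B ->
    P (B `&` U) = (\sum_(i <- a) P (B `&` race i))%E.
  move=> mB; rewrite /U setI_bigcupr measure_fin_bigcup.
  - by rewrite (fsbig_seq _ _ ua).
  - exact: finite_seq.
  - apply/trivIsetP => i j /= ia ja ij; apply/seteqP; split => // w.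
    move=> [[_ [_ /= ri]] [_ [_ /= rj]]].
    have := lt_trans (ri _ ja _) (rj _ ia ij).
    by rewrite eq_sym => /(_ ij); rewrite ltxx.
  - by move=> i ia; apply: measurableI => //; exact: measurable_race.
have mU : measurable U.
  apply: fin_bigcup_measurable; first exact: finite_seq.
  exact: measurable_race.
have UE : U `<=` E by move=> w [i _ []].
have PE : P E = p%:E.
  have := @clocks [::] (fun=> 0) isT; rewrite big_nil mulr1 => <- //.
  by congr (P _); apply/seteqP; split => // w [].
have PU : P U = P E.
  rewrite -[U]setTI sumP// PE.
  rewrite (@eq_big_seq _ _ _ _ _ _ (fun i => (p * (lam i / \sum_(c <- a) lam c))%:E)).
    rewrite sumEFin -mulr_sumr -mulr_suml divff ?mulr1//.
    rewrite gt_eqF//; case: a a0 aL => // c s _ sL; rewrite big_cons ltr_pwDl//.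
      by apply: lam0; apply: sL; rewrite mem_head.
    rewrite big_seq sumr_ge0// => j js; apply/ltW/lam0/sL.
    by rewrite inE js orbT.
  move=> i ia; rewrite setTI.
  have := exp_clocks_race mE mY lam0 clocks ua aL ia (fun w => @Y0 i w ia).
  move=> /(_ [::] (fun=> 0) isT); rewrite big_nil mulr1 => <- //.
  by congr (P _); apply/seteqP; split => // w [].
rewrite (measureDI P (measurableI _ _ mA mE) mU) -setIA (setIidr UE) -sumP//.
rewrite [X in (X + _)%E](_ : _ = 0%E) ?add0e//.
apply/eqP; rewrite eq_le measure_ge0 andbT.
have <- : P (E `\` U) = 0%E.
  transitivity (P E - P U)%E; last by rewrite PU PE subee.
  by rewrite measureD ?(setIidr UE)//; apply: le_lt_trans (ltry 1); exact: probability_le1.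
apply: le_measure; rewrite ?inE; last by move=> w [[]].
- by apply: measurableD => //; exact: measurableI.
- exact: measurableD.
Qed.

End RacePartition.

(** * Degrees and the law of the graph *)

Lemma degree_rcons G e j :
  degree (rcons G e) j = (degree G j + ((e.1 == j) + (e.2 == j)))%N.
Proof. by rewrite /degree -cats1 big_cat big_seq1. Qed.

Lemma BIinit_gt1 j : (1 < j)%N -> BIinit j = 1%N.
Proof. by case: j => [|[|j]]. Qed.

(** Truncated subtraction gives 0 for a node not yet present, as it should: in Model B its process
    may already run, without having jumped. *)
Definition jumps (G : seq (nat * nat)) (j : nat) : nat := (degree G j - BIinit j)%N.

(** Invariant of the growing graph; the total degree [n.*2] yields the attachment denominators. *)
Definition wf_graph (n : nat) (G : seq (nat * nat)) : Prop :=
  [/\ size G = n,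
      forall j, (1 <= j <= n)%N -> (BIinit j <= degree G j)%N,
      forall j, (n < j)%N -> degree G j = 0%N &
      (\sum_(j <- iota 1 n) degree G j = n.*2)%N].

Lemma wf_graph1 : wf_graph 1 [:: (1, 1)%N].
Proof.
split => //.
- by move=> j jn; rewrite (_ : j = 1%N) ?/degree ?big_seq1//; lia.
- by move=> j j1; rewrite /degree big_seq1 /= (ltn_eqF j1).
- by rewrite /= big_seq1 /degree big_seq1.
Qed.

Section WfGraph.
Variables (n : nat) (G : seq (nat * nat)) (i : nat).
Hypothesis n0 : (0 < n)%N.
Hypothesis wfG : wf_graph n G.
Hypothesis iP : (1 <= i <= n.+1)%N.

Lemma wf_graph_rcons : wf_graph n.+1 (rcons G (n.+1, i)).
Proof.
case: wfG => sG deg1 deg0 degs; split.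
- by rewrite size_rcons sG.
- move=> j jn; rewrite degree_rcons/=; have [jn'|jn'] := leqP j n.
    by rewrite (leq_trans (deg1 j _)) ?leq_addr//; lia.
  rewrite (_ : j = n.+1) ?eqxx ?BIinit_gt1//; lia.
- by move=> j jn; rewrite degree_rcons/= deg0; lia.
- rewrite -[in iota 1 n.+1](addn1 n) iotaD big_cat/= big_seq1 add1n addnC.
  rewrite degree_rcons/= deg0// eqxx.
  under eq_bigr do rewrite degree_rcons.
  rewrite big_split/= degs.
  rewrite (@eq_big_seq _ _ _ _ _ _ (fun j => nat_of_bool (i == j))); last first.
    by move=> j; rewrite mem_iota/= => jn; lia.
  have [->|iSn] := eqVneq i n.+1.
    rewrite big1_seq ?eqxx; first by lia.
    by move=> j /andP[_]; rewrite mem_iota => jn; lia.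
  rewrite (bigD1_seq i)/= ?iota_uniq ?eqxx//; last by rewrite mem_iota; lia.
  rewrite big1 => [|j ji]; last by rewrite eq_sym (negbTE ji).
  lia.
Qed.

(** The end of the edge at the new node only lifts its degree from 0 to the initial value 1 and
    counts as no jump; the other end is the jump, for a self loop too. *)
Lemma jumps_rcons j : (0 < j)%N ->
  jumps (rcons G (n.+1, i)) j = (jumps G j + (j == i))%N.
Proof.
case: wfG => _ deg1 deg0 _ j0; rewrite /jumps degree_rcons/=.
have [jn|jn] := leqP j n.
  by have := deg1 j; rewrite j0 jn => /(_ isT); lia.
by rewrite deg0// BIinit_gt1; lia.
Qed.

Lemma jumps_new j : (n < j)%N -> jumps G j = 0%N.
Proof. by case: wfG => _ _ deg0 _ nj; rewrite /jumps deg0. Qed.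

Lemma degree_jumps j : (1 <= j <= n)%N -> degree G j = (BIinit j + jumps G j)%N.
Proof. by case: wfG => _ deg1 _ _ /deg1 le; rewrite /jumps subnKC. Qed.

End WfGraph.

(** * Both attachment rules as choices proportional to jump rates *)

Section BranchLaw.
Variables (R : realType) (delta : R).

(** Written with [jumps] instead of the degree so as to be right also for node n+1 of Model B, which
    has degree 0 while its process already jumps at rate 1 + delta. *)
Definition rate (G : seq (nat * nat)) (j : nat) : R :=
  (BIinit j + jumps G j)%:R + delta.

(* [b = 0] is Model A; [b = 1] is Model B, where the process of the next node
   already runs and its jump creates a self loop. *)
Definition branch_step (b n : nat) (gp : seq (nat * nat) * R) :=
  [seq (rcons gp.1 (n.+1, i),
        gp.2 * (rate gp.1 i / \sum_(j <- iota 1 (n + b)) rate gp.1 j))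
  | i <- iota 1 (n + b)].

Fixpoint branch_law (b n : nat) : seq (seq (nat * nat) * R) :=
  match n with
  | 0 => [::]
  | n'.+1 => if n' == 0%N then [:: ([:: (1, 1)%N], 1)]
             else flatten [seq branch_step b n' gp | gp <- branch_law b n']
  end.

Lemma branch_law_wf b n gp : (b <= 1)%N -> (0 < n)%N ->
  gp \in branch_law b n -> wf_graph n gp.1.
Proof.
move=> b1; elim: n gp => // -[_|n IHn] gp _ /=.
  by rewrite inE => /eqP->; exact: wf_graph1.
move=> /flattenP[s /mapP[gp' gp'n ->] /mapP[i + ->]] /=; rewrite mem_iota => iP.
by apply: wf_graph_rcons => //; [exact: IHn|lia].
Qed.

Lemma sum_rate b n G : (b <= 1)%N -> (0 < n)%N -> wf_graph n G ->
  \sum_(j <- iota 1 (n + b)) rate G j = (2 + delta) * n%:R + b%:R * (1 + delta).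
Proof.
move=> b1 n0 wfG; rewrite iotaD big_cat/=; congr (_ + _); last first.
  case: b b1 => [|[]]// _; first by rewrite big_nil mul0r.
  by rewrite big_seq1 mul1r /rate (jumps_new wfG)// addn0 BIinit_gt1.
rewrite (@eq_big_seq _ _ _ _ _ _ (fun j => (degree G j)%:R + delta)); last first.
  by move=> j; rewrite mem_iota => jn; rewrite (degree_jumps wfG)//; lia.
rewrite big_split/= -natr_sum; case: wfG => _ _ _ ->.
rewrite big_const_seq count_predT size_iota iter_addr_0 -muln2 natrM -mulr_natr.
by ring.
Qed.

(** [F] is arbitrary so that the induction can take for it the sum over the graphs one step
    later. *)
Lemma lawA_branch n (F : seq (nat * nat) * R -> R) :
  \sum_(gp <- lawA delta n) F gp = \sum_(gp <- branch_law 0 n) F gp.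
Proof.
elim: n F => // -[//|n] IHn F.
rewrite [lawA _ _]/= [branch_law _ _]/= !big_flatten !big_map.
rewrite (IHn (fun gp => \sum_(gp' <- stepA delta n.+1 gp) F gp')).
apply: eq_big_seq => gp /branch_law_wf -/(_ isT isT) wfG; rewrite /stepA /branch_step !big_map.
rewrite sum_rate// mul0r addr0 addn0.
apply: eq_big_seq => i; rewrite mem_iota => iP.
by rewrite (@degree_jumps n.+1)// /rate; lia.
Qed.

(** The self loop comes first in [stepB] but last in [branch_step], so the lists differ in order and
    only sums over them are compared. *)
Lemma lawB_branch n (F : seq (nat * nat) * R -> R) :
  \sum_(gp <- lawB delta n) F gp = \sum_(gp <- branch_law 1 n) F gp.
Proof.
elim: n F => // -[//|n] IHn F.
rewrite [lawB _ _]/= [branch_law _ _]/= !big_flatten !big_map.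
rewrite (IHn (fun gp => \sum_(gp' <- stepB delta n.+1 gp) F gp')).
apply: eq_big_seq => gp /branch_law_wf -/(_ isT isT) wfG; rewrite /stepB /branch_step big_cons !big_map.
rewrite sum_rate// mul1r addrA [in iota _ (_ + 1)]iotaD big_cat [LHS]addrC.
congr (_ + _).
  apply: eq_big_seq => i; rewrite mem_iota => iP.
  by rewrite (@degree_jumps n.+1)// /rate; lia.
rewrite big_seq1 add1n /rate (@jumps_new n.+1) ?addn0 ?BIinit_gt1//.
Qed.

End BranchLaw.

(** * Branching times *)

Section Measurability.
Context {R : realType} {d : measure_display} {T : measurableType d}.

(* The infimum of the empty set is [0], hence the two cases. *)
Lemma measurable_fun_inf_above (D : nat -> nat -> Prop) (X : nat -> nat -> T -> R)
    (g : T -> R) :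
  (forall i k, D i k -> measurable_fun setT (X i k)) -> measurable_fun setT g ->
  measurable_fun setT
    (fun w => inf [set x | exists i k, D i k /\ x = X i k w /\ g w < x]).
Proof.
move=> mX mg.
pose A w := [set x | exists i k, D i k /\ x = X i k w /\ g w < x].
have mcup (B : nat -> nat -> set T) : (forall i k, D i k -> measurable (B i k)) ->
    measurable [set w | exists i k, D i k /\ B i k w].
  move=> mB; rewrite (_ : [set _ | _] =
      \bigcup_i \bigcup_k (if `[< D i k >] then B i k else set0)).
    apply: bigcupT_measurable => i; apply: bigcupT_measurable => k.
    by case: asboolP => // /mB.
  apply/seteqP; split => w /=.
    by move=> [i [k [Dik Bw]]]; exists i => //; exists k => //; rewrite asboolT.
  by move=> [i _ [k _]]; case: asboolP => // Dik Bw; exists i, k.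
have mA0 : measurable [set w | A w !=set0].
  rewrite (_ : [set _ | _] = [set w | exists i k, D i k /\ g w < X i k w]).
    apply: (mcup (fun i k => [set w | g w < X i k w])) => i k Dik.
    by apply: measurable_set_ltr => //; exact: mX.
  apply/seteqP; split => w /=.
    by move=> [x [i [k [Dik [-> gx]]]]]; exists i, k.
  by move=> [i [k [Dik gx]]]; exists (X i k w), i, k.
move=> mT; apply: (measurability _ (RGenInftyO.measurableE R)) => //.
move=> _ [_ [x ->] <-]; rewrite setTI.
rewrite (_ : _ @^-1` _ =
  [set w | exists i k, D i k /\ (g w < X i k w /\ X i k w < x)] `|`
  (~` [set w | A w !=set0] `&` [set w | 0 < x])).
  apply: measurableU; last first.
    apply: measurableI; first exact: measurableC.
    by apply: measurable_set_ltr.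
  apply: (mcup (fun i k => [set w | g w < X i k w /\ X i k w < x])) => i k Dik.
  by apply: measurableI; apply: measurable_set_ltr => //; exact: mX.
apply/seteqP; split => w /=; rewrite in_itv/=.
  move=> infx; have [A0|A0] := pselect (A w !=set0).
    left; have [y [i [k [Dik [yE gy]]]] yx] := inf_lt A0 infx.
    by exists i, k; split => //; rewrite -yE.
  right; split => //; move: infx.
  by have -> : [set x | exists i k, D i k /\ x = X i k w /\ g w < x] = set0;
    [apply/seteqP; split => // y Ay; apply: A0; exists y | rewrite inf0].
move=> [[i [k [Dik [gX Xx]]]]|[A0 x0]].
  apply: le_lt_trans Xx; apply: ge_inf; last by exists i, k.
  by exists (g w) => y [? [? [_ [_ /ltW]]]].
by have -> : [set x | exists i k, D i k /\ x = X i k w /\ g w < x] = set0;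
  [apply/seteqP; split => // y Ay; apply: A0; exists y | rewrite inf0].
Qed.

End Measurability.

(** * Histories of jumps and their probabilities, for both models at once *)

Section BranchingTimes.
Context {R : realType} {d : measure_display} {T : measurableType d}.
Variables (P : probability T R) (delta : R) (H : nat -> nat -> T -> R).
(** [S] stands for the branching times of Model A when b = 0 and of Model B when b = 1: process i
    starts at [S (i - b)], and n + b processes have started by [S n]. *)
Variables (b : nat) (S : nat -> T -> R).
Hypothesis delta1 : -1 < delta.
Hypothesis b1 : (b <= 1)%N.
Hypothesis HH : BI_holding_times P delta H.
Hypothesis S0 : forall n w, (n <= 1)%N -> S n w = 0.
Hypothesis SS : forall n w, (0 < n)%N -> S n.+1 w =
  inf [set x | exists i k, (1 <= i <= n + b)%N /\ (1 <= k)%N /\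
               x = S (i - b) w + tau H i k w /\ S n w < x].

Lemma tau0 i w : tau H i 0 w = 0.
Proof. by rewrite /tau big_geq. Qed.

Lemma tauS i k w : tau H i k.+1 w = tau H i k w + H i k.+1 w.
Proof. by rewrite /tau big_nat_recr. Qed.

Lemma measurable_H i k : (0 < i)%N -> (0 < k)%N -> measurable_fun setT (H i k).
Proof. by move=> i0 k0; case: HH => /(_ i k i0 k0) []. Qed.

Lemma measurable_tau i k : (0 < i)%N -> measurable_fun setT (tau H i k).
Proof.
move=> i0; elim: k => [|k IHk].
  by rewrite (_ : tau H i 0 = cst 0)//; apply/funext => w; exact: tau0.
rewrite (_ : tau H i k.+1 = tau H i k \+ H i k.+1).
  by apply: measurable_funD => //; exact: measurable_H.
by apply/funext => w; exact: tauS.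
Qed.

Lemma measurable_S n : measurable_fun setT (S n).
Proof.
have [m] := ubnP n; elim: m n => // m IHm [|[|n]] nm.
- by rewrite (_ : S 0 = cst 0)//; apply/funext => w; rewrite S0.
- by rewrite (_ : S 1 = cst 0)//; apply/funext => w; rewrite S0.
rewrite (_ : S n.+2 = fun w => inf [set x | exists i k,
    ((1 <= i <= n.+1 + b)%N /\ (1 <= k)%N) /\
    x = S (i - b) w + tau H i k w /\ S n.+1 w < x]).
  apply: measurable_fun_inf_above; last exact: IHm.
  move=> i k [ni _]; apply: measurable_funD; first by apply: IHm; lia.
  by apply: measurable_tau; lia.
apply/funext => w; rewrite SS//; congr inf; apply/seteqP; split => x /=.
  by move=> [i [k [? [? ?]]]]; exists i, k.
by move=> [i [k [[? ?] ?]]]; exists i, k.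
Qed.

(** An event of probability 1 on which the jump times of each process strictly increase; inside it
    the arguments are pointwise. *)
Definition positive_holding : set T := [set w | forall i k, 0 < H i.+1 k.+1 w].

Lemma measurable_positive_holding : measurable positive_holding.
Proof.
rewrite (_ : positive_holding = \bigcap_i \bigcap_k [set w | 0 < H i.+1 k.+1 w]).
  apply: bigcapT_measurable => i; apply: bigcapT_measurable => k.
  by apply: measurable_set_ltr => //; exact: measurable_H.
by apply/seteqP; split => w /= h i => [_ k _|k]; exact: h.
Qed.

Lemma probability_positive_holding A : measurable A ->
  P (A `&` positive_holding) = P A.
Proof.
move=> mA; have mE := measurable_positive_holding.
rewrite [RHS](measureDI P mA mE) [X in (X + _)%E](_ : _ = 0%E) ?add0e//.
apply: measure_negligible; first exact: measurableD.
apply: (@negligibleS _ _ _ _ (\bigcup_i \bigcup_k [set w | H i.+1 k.+1 w <= 0])).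
  move=> w [_] /existsNP[i /existsNP[k /negP]]; rewrite -leNgt => Hle.
  by exists i => //; exists k.
apply: negligible_bigcup => i; apply: negligible_bigcup => k.
have [mH HP] := HH.1 i.+1 k.+1 isT isT.
exists [set w | H i.+1 k.+1 w <= 0]; split => //.
  rewrite (_ : [set _ | _] = H i.+1 k.+1 @^-1` `]-oo, 0]%classic).
    by rewrite -[_ @^-1` _]setTI; exact: mH.
  by apply/seteqP; split => w /=; rewrite in_itv.
by apply: (etrans (HP 0)); rewrite ltxx mulr0 expR0 subrr.
Qed.

Lemma tau_lt i k l w : positive_holding w -> (0 < i)%N ->
  (tau H i k w < tau H i l w) = (k < l)%N.
Proof.
case: i => // i pw _.
have lt_tau m n : (m < n)%N -> tau H i.+1 m w < tau H i.+1 n w.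
  elim: n => // n IHn; rewrite ltnS leq_eqVlt => /orP[/eqP->|/IHn].
    by rewrite tauS ltrDl.
  by move/lt_trans; apply; rewrite tauS ltrDl.
have [/lt_tau//|lk|->] := ltngtP k l; last by rewrite ltxx.
by apply/negbTE; rewrite -leNgt; exact/ltW/lt_tau.
Qed.

Lemma tau_le i k l w : positive_holding w -> (0 < i)%N ->
  (tau H i k w <= tau H i l w) = (k <= l)%N.
Proof. by move=> pw i0; rewrite leNgt tau_lt// -leqNgt. Qed.

(** By time [S n] each started process has made exactly the jumps that [G] records. *)
Definition on_course (n : nat) (G : seq (nat * nat)) (w : T) : Prop :=
  forall j, (1 <= j <= n + b)%N ->
    S (j - b) w + tau H j (jumps G j) w <= S n w
      < S (j - b) w + tau H j (jumps G j).+1 w.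

(** Any jump after [S n] is at least the next jump of its own process, and the winner has the
    earliest of these; so the infimum defining [S n.+1] is attained there. *)
Lemma on_course_step n G i w :
  positive_holding w -> (0 < n)%N -> wf_graph n G -> (1 <= i <= n + b)%N ->
  on_course n G w ->
  (forall j, (1 <= j <= n + b)%N -> j != i ->
     S (i - b) w + tau H i (jumps G i).+1 w < S (j - b) w + tau H j (jumps G j).+1 w) ->
  S n.+1 w = S (i - b) w + tau H i (jumps G i).+1 w /\
  on_course n.+1 (rcons G (n.+1, i)) w.
Proof.
move=> pw n0 wfG iP ok race.
have i0 : (0 < i)%N by case/andP: iP.
have SE : S n.+1 w = S (i - b) w + tau H i (jumps G i).+1 w.
  rewrite SS//; set A := [set x | _].
  have Ai : A (S (i - b) w + tau H i (jumps G i).+1 w).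
    by exists i, (jumps G i).+1; do !split => //; case/andP: (ok i iP).
  have lbA : lbound A (S (i - b) w + tau H i (jumps G i).+1 w).
    move=> x [j [k [jP [k0 [-> xS]]]]].
    have j0 : (0 < j)%N by case/andP: jP.
    have /andP[le1 _] := ok j jP.
    have Jk : (jumps G j < k)%N.
      by rewrite -(tau_lt _ _ pw j0) -(ltrD2l (S (j - b) w)) (le_lt_trans le1).
    have [<-|ji] := eqVneq j i; first by rewrite lerD2l tau_le.
    by rewrite (le_trans (ltW (race j jP ji)))// lerD2l tau_le.
  apply/le_anti/andP; split.
    by apply: ge_inf Ai; exists (S (i - b) w + tau H i (jumps G i).+1 w).
  by apply: lb_le_inf lbA; exists (S (i - b) w + tau H i (jumps G i).+1 w).
split => // j jP; have j0 : (0 < j)%N by case/andP: jP.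
have iP' : (1 <= i <= n.+1)%N by lia.
rewrite (jumps_rcons n0 wfG iP' j0).
have [jn|jn] := leqP j (n + b); last first.
  (* This process starts at [S n.+1] itself and has no jump yet. *)
  have -> : j = (n.+1 + b)%N by lia.
  rewrite addnK (jumps_new wfG); last by lia.
  rewrite (_ : (_ == i) = false); last by apply/negbTE; lia.
  rewrite addn0 tau0 addr0 lexx/= ltrDl -(tau0 (n.+1 + b) w) tau_lt//.
have jP' : (1 <= j <= n + b)%N by rewrite j0.
have /andP[le1 lt1] := ok j jP'.
have [->|ji] := eqVneq j i.
  by rewrite addn1 SE lexx/= ltrD2l tau_lt.
rewrite addn0 SE race// andbT; apply/ltW/(le_lt_trans le1).
by have /andP[] := ok i iP.
Qed.

Definition clock_rate (c : nat * nat) : R := (BIinit c.1 + c.2 - 1)%:R + delta.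

(** The clock (j, k) is the k-th holding time of process j. All clocks that have not rung are kept,
    also those of future nodes, since their independence is used in later races. *)
Definition live (G : seq (nat * nat)) (c : nat * nat) : Prop :=
  (0 < c.1)%N /\ (jumps G c.1 < c.2)%N.

Definition running (n : nat) (G : seq (nat * nat)) : seq (nat * nat) :=
  [seq (j, (jumps G j).+1) | j <- iota 1 (n + b)].

(* Time left at [S n] on a clock that is running; a clock not yet started
   shows its whole holding time. *)
Definition residual (n : nat) (G : seq (nat * nat)) (c : nat * nat) (w : T) : R :=
  if (c.1 <= n + b)%N && (c.2 == (jumps G c.1).+1)
  then S (c.1 - b) w + tau H c.1 c.2 w - S n w else H c.1 c.2 w.

(** The induction invariant: [E] is the event that the jumps occurred as [G] records, [p] its
    probability, and given [E] the residual times are fresh exponential clocks. *)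
Definition history (n : nat) (G : seq (nat * nat)) (p : R) (E : set T) : Prop :=
  [/\ measurable E, E `<=` positive_holding, E `<=` on_course n G &
      exp_clocks P E p (live G) clock_rate (residual n G)].

Definition wins (n : nat) (G : seq (nat * nat)) (i : nat) : set T :=
  [set w | forall c, c \in running n G -> c != (i, (jumps G i).+1) ->
     residual n G (i, (jumps G i).+1) w < residual n G c w].

Lemma mem_running n G c : (c \in running n G) =
  (1 <= c.1 <= n + b)%N && (c.2 == (jumps G c.1).+1).
Proof.
case: c => j k; apply/mapP/andP => /= [[j' + [-> ->]]|[jP /eqP->]].
  by rewrite mem_iota eqxx; lia.
by exists j => //; rewrite mem_iota; lia.
Qed.

Lemma running_uniq n G : uniq (running n G).
Proof. by rewrite map_inj_uniq ?iota_uniq// => i j []. Qed.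

Lemma running_live n G c : c \in running n G -> live G c.
Proof. by rewrite mem_running => /andP[/andP[c0 _] /eqP cE]; split => //; rewrite cE. Qed.

Lemma clock_rate_gt0 G c : live G c -> 0 < clock_rate c.
Proof.
move=> [c0 cJ]; rewrite /clock_rate.
have : (1 <= BIinit c.1 + c.2 - 1)%N by rewrite /BIinit; case: ifP => _; lia.
by rewrite -(ler_nat R) mulr1n; move: delta1; lra.
Qed.

Lemma clock_rate_running G j : clock_rate (j, (jumps G j).+1) = rate delta G j.
Proof. by rewrite /clock_rate/= addnS subn1. Qed.

Lemma measurable_residual n G c : live G c -> measurable_fun setT (residual n G c).
Proof.
move=> [c0 cJ]; rewrite /residual; case: ((c.1 <= n + b)%N && _); last by apply: measurable_H; lia.
apply: measurable_funB; last exact: measurable_S.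
by apply: measurable_funD; [exact: measurable_S|exact: measurable_tau].
Qed.

Lemma residual_gt0 n G c w : c \in running n G -> on_course n G w ->
  0 < residual n G c w.
Proof.
rewrite mem_running => /andP[cP /eqP cE] /(_ _ cP) /andP[_].
by rewrite /residual cE eqxx; case/andP: cP => _ ->; rewrite subr_gt0.
Qed.

(** Since [S 1] is 0, running clocks too show their whole holding times, and the clock property is
    the independence and the exponential tails of these. *)
Lemma history_start : history 1 [:: (1, 1)%N] 1 positive_holding.
Proof.
have J0 j : jumps [:: (1, 1)%N] j = 0%N.
  have [j1|j1] := leqP j 1; last exact: (jumps_new wf_graph1).
  by case: j j1 => [|[|]]; rewrite // /jumps /degree big_seq1.
split => //.
- exact: measurable_positive_holding.
- move=> w pw j jP; rewrite J0 tau0 !S0//; last by lia.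
  by rewrite addr0 lexx add0r/= -(tau0 j w) tau_lt//; lia.
- move=> s y us sL y0.
  have sJ c : c \in s -> (1 <= c.1)%N /\ (1 <= c.2)%N.
    by move=> /sL[c0]; rewrite J0.
  rewrite (_ : _ `&` _ =
      (\bigcap_(c in [set c | c \in s]) (H c.1 c.2 @^-1` `]y c, +oo[%classic)) `&`
      positive_holding).
    rewrite probability_positive_holding; last first.
      apply: fin_bigcap_measurable => [|c cs]; first exact: finite_seq.
      have [c1 c2] := sJ c cs.
      by rewrite -[_ @^-1` _]setTI; exact: (measurable_H c1 c2).
    rewrite HH.2//.
    rewrite mul1r -prodEFin; apply: eq_big_seq => c cs; have [c1 c2] := sJ c cs.
    have [mHc HP] := HH.1 _ _ c1 c2.
    rewrite (_ : _ @^-1` _ = ~` [set w | H c.1 c.2 w <= y c]); last first.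
      by apply/seteqP; split => w /=; rewrite in_itv/= andbT ltNge => /negP.
    rewrite probability_setC; last first.
      rewrite (_ : [set _ | _] = H c.1 c.2 @^-1` `]-oo, y c]%classic).
        by rewrite -[_ @^-1` _]setTI; exact: mHc.
      by apply/seteqP; split => w /=; rewrite in_itv.
    rewrite HP ltNge y0//= -EFinB; congr EFin.
    by rewrite opprB addrC subrK.
  apply/seteqP; split => w /=.
    move=> [pw sY]; split => // c /= cs; rewrite in_itv/= andbT.
    have := sY c cs; rewrite /residual J0; case: ifP => // /andP[c1b /eqP->].
    by rewrite !S0 ?tauS ?tau0//; [rewrite subr0 !add0r|lia].
  move=> [sY pw]; split => // c cs; have := sY c cs; rewrite /= in_itv/= andbT.
  rewrite /residual J0; case: ifP => // /andP[c1b /eqP->].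
  by rewrite !S0 ?tauS ?tau0//; [rewrite subr0 !add0r|lia].
Qed.

Section Step.
Variables (n : nat) (G : seq (nat * nat)) (p : R) (E : set T).
Hypothesis n0 : (0 < n)%N.
Hypothesis wfG : wf_graph n G.
Hypothesis hist : history n G p E.

Lemma wins_on_course i w : (1 <= i <= n + b)%N -> E w -> wins n G i w ->
  S n.+1 w = S (i - b) w + tau H i (jumps G i).+1 w /\
  on_course n.+1 (rcons G (n.+1, i)) w.
Proof.
case: hist => _ Epos Eok _ iP Ew win.
apply: on_course_step => //; [exact: Epos|exact: Eok|].
move=> j jP ji; have := win (j, (jumps G j).+1).
rewrite mem_running/= eqxx andbT => /(_ jP); rewrite /residual/= !eqxx.
have [-> ->] : (i <= n + b)%N /\ (j <= n + b)%N by lia.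
rewrite /= ltrD2r; apply.
by apply: contra ji => /eqP[->].
Qed.

Lemma measurable_wins i : (1 <= i <= n + b)%N -> measurable (E `&` wins n G i).
Proof.
move=> iP; case: hist => mE _ _ _.
apply: (measurable_race mE (@measurable_residual n G) (@running_live n G)).
by rewrite mem_running/= eqxx iP.
Qed.

(** [exp_clocks_race] applied to the running clocks; what remains is to recognise its shifted clocks
    as the residual times at [S n.+1]. *)
Lemma history_step i : (1 <= i <= n + b)%N ->
  history n.+1 (rcons G (n.+1, i))
    (p * (rate delta G i / \sum_(j <- iota 1 (n + b)) rate delta G j))
    (E `&` wins n G i).
Proof.
move=> iP; have [mE Epos Eok clocks] := hist.
have iP' : (1 <= i <= n.+1)%N by lia.
have JE j := @jumps_rcons n G i n0 wfG iP' j.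
have ir : (i, (jumps G i).+1) \in running n G by rewrite mem_running/= eqxx iP.
split.
- exact: measurable_wins.
- by move=> w [/Epos].
- by move=> w [Ew win]; have [] := wins_on_course iP Ew win.
move=> s y us sL y0.
have := exp_clocks_race mE (@measurable_residual n G) (@clock_rate_gt0 G) clocks
  (running_uniq n G) (@running_live n G) ir (fun w Ew => residual_gt0 ir (Eok w Ew)).
move=> /(_ s y us) race; rewrite clock_rate_running big_map in race.
under [X in (_ / X)]eq_bigr do rewrite -clock_rate_running.
rewrite -race//; last first.
  move=> c /sL[c0]; rewrite JE// => cJ; split; first by split => //; lia.
  by apply/eqP => cE; move: cJ; rewrite cE/= eqxx; lia.
(* The other running clocks lose the residual time of the winner; the next clock of process i and
   the first clock of the process starting at [S n.+1] show their whole holding times. *)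
have resE c w : E w -> wins n G i w -> c \in s ->
    residual n.+1 (rcons G (n.+1, i)) c w =
    if c \in running n G then residual n G c w - residual n G (i, (jumps G i).+1) w
    else residual n G c w.
  move=> Ew win /sL[]; case: c => j k /= j0.
  have [SE _] := wins_on_course iP Ew win.
  rewrite mem_running /residual/= JE// j0 eqxx SE.
  have -> : (i <= n + b)%N by case/andP: iP.
  have [->|ji] := eqVneq j i.
    rewrite addn1 => Jk; have -> : (i <= n.+1 + b)%N by lia.
    have -> : (k == (jumps G i).+1) = false by apply/negbTE; lia.
    rewrite !andbF/=; case: eqP => // ->.
    by rewrite [tau H i (jumps G i).+2 w]tauS; lra.
  rewrite addn0 => Jk; have [jn|jn] := leqP j (n + b).
    have -> : (j <= n.+1 + b)%N by lia.
    by rewrite /=; case: eqP => // _; lra.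
  have [jn'|jn'] := leqP j (n.+1 + b); last by [].
  have -> : j = (n.+1 + b)%N by lia.
  rewrite addnK (jumps_new wfG) /=; last by lia.
  by case: eqP => // ->; rewrite SE (tauS (n.+1 + b) 0) tau0; lra.
congr (P _); apply/seteqP; split => w [[Ew win] sY]; split => // c cs.
  by rewrite -resE//; exact: sY.
by rewrite resE//; exact: sY.
Qed.

Lemma history_partition A : measurable A ->
  P (A `&` E) = (\sum_(i <- iota 1 (n + b)) P (A `&` (E `&` wins n G i)))%E.
Proof.
have [mE Epos Eok clocks] := hist.
move=> mA; rewrite (race_partition mE (@measurable_residual n G) (@clock_rate_gt0 G)
  clocks (running_uniq n G) _ (@running_live n G) _ mA); last 2 first.
- by rewrite -size_eq0 size_map size_iota; lia.
- by move=> c w cr /Eok; exact: residual_gt0.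
by rewrite big_map.
Qed.

End Step.

(** The ordered edge list determines the order of the jumps, so histories can be indexed by graphs;
    by the race partitions they exhaust the probability. *)
Lemma branch_histories n : (0 < n)%N ->
  exists Ev : seq (nat * nat) -> set T,
    (forall gp, gp \in branch_law delta b n -> history n gp.1 gp.2 (Ev gp.1)) /\
    (forall A, measurable A ->
       P A = (\sum_(gp <- branch_law delta b n) P (A `&` Ev gp.1))%E).
Proof.
elim: n => // -[_ _|n /(_ isT) [Ev [hist part]] _].
  exists (fun=> positive_holding); split => [gp|A mA].
    by rewrite inE => /eqP->; exact: history_start.
  by rewrite big_seq1 probability_positive_holding.
(* The second end of the last edge names the winner of the last race; the edges before it encode the
   earlier history. *)
exists (fun G => Ev (take n.+1 G) `&` wins n.+1 (take n.+1 G) (last (0, 0)%N G).2).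
have take_rcons gp e : gp \in branch_law delta b n.+1 -> take n.+1 (rcons gp.1 e) = gp.1.
  by move=> /(branch_law_wf b1)-/(_ isT)[sG _ _ _]; rewrite -cats1 -sG take_size_cat.
split => [gp|A mA].
  move=> /flattenP[s /mapP[gp' gp'n ->] /mapP[i + ->]]; rewrite mem_iota => iP.
  cbn [fst snd]; rewrite last_rcons take_rcons//.
  have wfG : wf_graph n.+1 gp'.1 by exact: (@branch_law_wf _ delta b).
  by apply: (history_step _ wfG (hist gp' gp'n)) => //; lia.
rewrite (part A mA) [branch_law _ _ n.+2]/= big_flatten big_map.
apply: eq_big_seq => gp gpn; rewrite big_map.
rewrite (history_partition _ (hist _ gpn) mA)//.
by apply: eq_bigr => i _; cbn [fst snd]; rewrite last_rcons take_rcons.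
Qed.

(** Both conditions place the same time between consecutive jump times, and strict monotonicity of
    [tau] leaves only one such interval. *)
Lemma BI_is_on_course n G i v w : wf_graph n G -> (1 <= i <= n)%N ->
  positive_holding w -> on_course n G w ->
  BI_is H i (S n w - S (i - b) w) v w <-> v = degree G i.
Proof.
move=> wfG iP pw ok; have i0 : (0 < i)%N by case/andP: iP.
have /ok/andP[le1 lt1] : (1 <= i <= n + b)%N by lia.
rewrite (degree_jumps wfG iP) /BI_is; split => [[Bv /andP[le2 lt2]]|->].
  have : (jumps G i < (v - BIinit i).+1)%N.
    by rewrite -(tau_lt _ _ pw i0); lra.
  have : (v - BIinit i < (jumps G i).+1)%N.
    by rewrite -(tau_lt _ _ pw i0); lra.
  by lia.
by rewrite leq_addr addKn; split => //; apply/andP; split; lra.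
Qed.

Lemma measurable_BI_is n i v : (0 < i)%N ->
  measurable [set w | BI_is H i (S n w - S (i - b) w) v w].
Proof.
move=> i0; have mD : measurable_fun setT (fun w => S n w - S (i - b) w).
  by apply: measurable_funB; exact: measurable_S.
have [Bv|Bv] := boolP (BIinit i <= v)%N; last first.
  rewrite (_ : [set _ | _] = set0)//; apply/seteqP; split => // w [].
  by move: Bv => /negbTE ->.
rewrite (_ : [set _ | _] =
  ~` [set w | S n w - S (i - b) w < tau H i (v - BIinit i) w] `&`
  [set w | S n w - S (i - b) w < tau H i (v - BIinit i).+1 w]).
  apply: measurableI; first apply: measurableC.
    by apply: measurable_set_ltr => //; exact: measurable_tau.
  by apply: measurable_set_ltr => //; exact: measurable_tau.
apply/seteqP; split => w /=.
  by move=> [_ /andP[le1 lt1]]; split => //; apply/negP; rewrite -leNgt.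
by move=> [/negP]; rewrite -leNgt => le1 lt1; split => //; rewrite le1 lt1.
Qed.

(** On the event of a history the processes have the degrees of its graph, so that event lies inside
    the event in question or is disjoint from it. *)
Lemma branching_degrees n ds : (0 < n)%N -> size ds = n ->
  P [set w | forall i, (1 <= i <= n)%N ->
       BI_is H i (S n w - S (i - b) w) (nth 0%N ds i.-1) w] =
  (\sum_(gp <- branch_law delta b n | degseq n gp.1 == ds) gp.2)%:E.
Proof.
move=> n0 sds; set A := [set w | _].
have mA : measurable A.
  rewrite (_ : A = [set w | forall i, i \in iota 1 n ->
      [set w | BI_is H i (S n w - S (i - b) w) (nth 0%N ds i.-1) w] w]).
    apply: measurable_forall_seq => i; rewrite mem_iota => iP.
    by apply: measurable_BI_is; lia.
  by apply/seteqP; split => w Aw i; have := Aw i; rewrite mem_iota add1n ltnS.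
have [Ev [hist part]] := branch_histories n0.
rewrite (part A mA) [RHS](_ : _ = (\sum_(gp <- branch_law delta b n)
  (if degseq n gp.1 == ds then gp.2 else 0)%:E)%E); last first.
  by rewrite sumEFin big_mkcond.
apply: eq_big_seq => gp gpn; have wfG := branch_law_wf b1 n0 gpn.
have [mE Epos Eok clocks] := hist gp gpn.
have degE : (degseq n gp.1 == ds) <->
    forall i, (1 <= i <= n)%N -> nth 0%N ds i.-1 = degree gp.1 i.
  split => [/eqP<- i iP|dsE].
    rewrite /degseq (nth_map 0%N) ?size_iota; last by lia.
    by rewrite nth_iota; [congr degree|]; lia.
  apply/eqP/(@eq_from_nth _ 0%N); rewrite /degseq size_map size_iota// => i iP.
  rewrite (nth_map 0%N) ?size_iota// nth_iota// -(dsE (1 + i)%N)//; lia.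
case: ifPn => [/degE dsE|/negP dsN].
  (* With no clock constrained, [exp_clocks] gives the probability of the history itself. *)
  have := clocks [::] (fun=> 0) isT; rewrite big_nil mulr1 => <- //.
  congr (P _); apply/seteqP; split => w [].
    by move=> Aw Ew; split.
  move=> Ew _; split => // i iP.
  by apply/(BI_is_on_course _ wfG) => //; [exact: Epos|exact: Eok|exact: dsE].
rewrite (_ : _ `&` _ = set0) ?measure0//; apply/seteqP; split => // w [Aw Ew].
apply: dsN; apply/degE => i iP.
by apply/(BI_is_on_course _ wfG iP (Epos _ Ew) (Eok _ Ew)); exact: Aw.
Qed.

End BranchingTimes.

(** * The branching times of the two models as instances *)

Section ModelTimes.
Context {R : realType} {d : measure_display} {T : measurableType d}.
Variable H : nat -> nat -> T -> R.

Lemma TAf_TA n j w : (j <= n)%N -> TAf H n w j = TA H j w.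
Proof.
elim: n j => [|n IHn] j; first by rewrite leqn0 => /eqP->.
rewrite leq_eqVlt => /orP[/eqP->//|]; rewrite ltnS => jn /=.
by case: eqP => [n0|_]; [case: j jn => // j; rewrite n0|rewrite jn IHn].
Qed.

Lemma TBf_TB n j w : (j <= n)%N -> TBf H n w j = TB H j w.
Proof.
elim: n j => [|n IHn] j; first by rewrite leqn0 => /eqP->.
rewrite leq_eqVlt => /orP[/eqP->//|]; rewrite ltnS => jn /=.
by case: eqP => [n0|_]; [case: j jn => // j; rewrite n0|rewrite jn IHn].
Qed.

(** Brings the definition into the form [SS] with b = 0; [TB_rec] does so with b = 1. *)
Lemma TA_rec n w : (0 < n)%N -> TA H n.+1 w =
  inf [set x | exists i k, (1 <= i <= n + 0)%N /\ (1 <= k)%N /\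
               x = TA H (i - 0) w + tau H i k w /\ TA H n w < x].
Proof.
move=> n0; rewrite {1}/TA/= gtn_eqF// ltnn; congr inf.
apply/seteqP; split => x /= [i [k]]; rewrite ?addn0 ?subn0 => -[iP [k0 [xE lt]]];
  exists i, k; rewrite ?addn0 ?subn0; do 3?split => //.
- by rewrite xE TAf_TA//; case/andP: iP.
- by rewrite xE TAf_TA//; case/andP: iP.
Qed.

Lemma TB_rec n w : (0 < n)%N -> TB H n.+1 w =
  inf [set x | exists i k, (1 <= i <= n + 1)%N /\ (1 <= k)%N /\
               x = TB H (i - 1) w + tau H i k w /\ TB H n w < x].
Proof.
move=> n0; rewrite {1}/TB/= gtn_eqF// ltnn; congr inf.
apply/seteqP; split => x /= [i [k]]; rewrite ?addn1 ?subn1 => -[iP [k0 [xE lt]]];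
  exists i, k; rewrite ?addn1 ?subn1; do 3?split => //.
- by rewrite xE TBf_TB//; lia.
- by rewrite xE TBf_TB//; lia.
Qed.

End ModelTimes.

Unset Implicit Arguments.

Theorem mainTheorem1 (R : realType) (d : measure_display) (T : measurableType d)
    (P : probability T R) (delta : R) (H : nat -> nat -> T -> R) (n : nat) :
  -1 < delta -> (1 <= n)%N ->
  BI_holding_times P delta H ->
  (forall ds : seq nat, size ds = n ->
     P (tildeDA_is H n ds) = (degpmfA delta n ds)%:E) /\
  (forall ds : seq nat, size ds = n ->
     P (tildeDB_is H n ds) = (degpmfB delta n ds)%:E).
Proof.
move=> delta1 n1 HH; split => ds sds.
- have TA0 m w : (m <= 1)%N -> TA H m w = 0 by case: m => [|[|]].
  (* The condition on the degrees moves into the summand, which is where [lawA_branch] admits it. *)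
  rewrite /degpmfA big_mkcond lawA_branch -big_mkcond.
  rewrite -(branching_degrees delta1 (isT : (0 <= 1)%N) HH TA0 (TA_rec H) n1 sds).
  by congr (P _); apply/seteqP; split => w tw i iP; have := tw i iP; rewrite subn0.
- have TB0 m w : (m <= 1)%N -> TB H m w = 0 by case: m => [|[|]].
  rewrite /degpmfB big_mkcond lawB_branch -big_mkcond.
  rewrite -(branching_degrees delta1 (isT : (1 <= 1)%N) HH TB0 (TB_rec H) n1 sds).
  by congr (P _); apply/seteqP; split => w tw i iP; have := tw i iP; rewrite subn1.
Qed.
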